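(* Let $r$ be the number of maximal equal-letter runs in the Burrows-Wheeler transform of a string $T$. Then $T$ has a string attractor of size $r$.
   Context: A string attractor of a string $T$ of length $n$ is a set $\Gamma\subseteq\{1,\dots,n\}$ such that every substring $T[i..j]$ has an occurrence $T[i'..j']=T[i..j]$ with $p\in[i',j']$ for some $p\in\Gamma$. It is assumed that $T[n]=\$$, a symbol not occurring elsewhere in $T$ and lexicographically smaller than all other symbols. The suffix array $SA$ of $T$ is the permutation of $[1..n]$ listing starting positions of suffixes in lexicographic order; the Burrows-Wheeler transform is $BWT[i]=T[SA[i]-1]$ if $SA[i]>1$ and $\$$ otherwise (equivalently, the last column of the lexicographically sorted matrix of cyclic rotations of $T$). *)

(* Defs.v *)
From HB Require Import structures.
From mathcomp Require Import all_boot all_order.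

Set Implicit Arguments.
Unset Strict Implicit.
Unset Printing Implicit Defensive.

(* All positions are 0-based: position k here is position k + 1 in the usual
   1-based indexing of strings. *)

Section Substrings.
Variable A : eqType.
Implicit Types (T s : seq A).

(* T[i..j], both ends included; meaningful for i <= j < size T. *)
Definition substring T (i j : nat) : seq A := take (j.+1 - i) (drop i T).

Definition string_attractor T (G : {set 'I_(size T)}) : Prop :=
  forall i j : 'I_(size T), i <= j ->
  exists i' j' p : 'I_(size T),
    [/\ substring T i' j' = substring T i j, p \in G & i' <= p <= j'].

Definition equal_letter_run s (i j : nat) : bool :=
  [&& i <= j, j < size s & constant (substring s i j)].

Definition maximal_run s (i j : 'I_(size s)) : bool :=
  equal_letter_run s i j &&
  [forall i' : 'I_(size s), forall j' : 'I_(size s),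
     [&& i' <= i, j <= j' & equal_letter_run s i' j'] ==>
     (i' == i) && (j' == j)].

Definition num_runs s : nat :=
  #|[set ij : 'I_(size s) * 'I_(size s) | maximal_run ij.1 ij.2]|.

End Substrings.

Section BurrowsWheeler.
Variables (disp : Order.disp_t) (A : orderType disp).
Implicit Types (T : seq A) (dollar : A).

Definition dollar_terminated dollar T : Prop :=
  (exists2 s : seq A, T = rcons s dollar & dollar \notin s) /\
  (forall a : A, a != dollar -> (dollar < a)%O).

Definition suffix_le T (i j : nat) : bool :=
  ((drop i T : seqlexi A) <= (drop j T : seqlexi A))%O.

Definition suffix_array T : seq nat := sort (suffix_le T) (iota 0 (size T)).

Definition bwt dollar T : seq A :=
  [seq if 0 < k then nth dollar T k.-1 else dollar | k <- suffix_array T].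

End BurrowsWheeler.

(* Main.v *)
Require Import Defs.
From HB Require Import structures.
From mathcomp Require Import all_boot all_order.

Set Implicit Arguments.
Unset Strict Implicit.
Unset Printing Implicit Defensive.

Import Order.TTheory.

(** The attractor consists of the text positions of the letters that start a
    run of the Burrows-Wheeler transform.  Given a nonempty substring [w], let
    [i] be its lexicographically smallest occurrence, that is, the one whose
    suffix comes first in the suffix array.  If [i] is not in the attractor,
    the suffix just before the one at [i.+1] in the suffix array is also
    preceded by the first letter of [w], so it cannot start with the tail of
    [w].  Hence the tail is nonempty and [i.+1] is its lexicographically
    smallest occurrence, and the argument repeats until an attractor position
    is met inside the occurrence of [w] at [i]. *)

(** * Maximal runs of a sequence and their starting positions *)

Section Runs.
Variables (A : eqType) (x0 : A).
Implicit Types (s : seq A).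

(** The case [i == 0] is separate because [0.-1] is [0], so the letter comparison alone would reject
    the first position. *)
Definition run_start s (i : nat) : bool :=
  (i == 0) || (nth x0 s i.-1 != nth x0 s i).

Lemma equal_letter_runP s i j :
  reflect [/\ i <= j, j < size s &
             forall k, i <= k <= j -> nth x0 s k = nth x0 s i]
          (equal_letter_run s i j).
Proof.
apply: (iffP and3P) => -[le_ij lt_js].
- have lt_is := leq_ltn_trans le_ij lt_js.
  rewrite /substring (drop_nth x0 lt_is) subSn //= => /allP eq_ij; split=> // k.
  case/andP; rewrite leq_eqVlt => /predU1P[-> // | lt_ik le_kj].
  have lt_kj : k - i.+1 < j - i by rewrite subnSK // leq_sub2r.
  apply/eqP/eq_ij; rewrite -(subnKC lt_ik) -nth_drop -(nth_take _ lt_kj).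
  by rewrite mem_nth // size_takel // size_drop leq_subRL // addSn subnKC.
- move=> eq_ij; split=> //; have lt_is := leq_ltn_trans le_ij lt_js.
  rewrite /substring (drop_nth x0 lt_is) subSn //=; apply/(all_nthP x0) => k.
  rewrite size_takel => [lt_k|]; last first.
    by rewrite size_drop leq_subRL // addSn subnKC.
  rewrite nth_take // nth_drop /= eq_ij // addSnnS leq_addr /=.
  by rewrite -leq_subRL.
Qed.

(** Were the letters at [i.-1] and [i] equal, the run could be extended by one position to the left,
    against maximality. *)
Lemma run_start_maximal_run s (i j : 'I_(size s)) :
  maximal_run i j -> run_start s i.
Proof.
case/andP=> /equal_letter_runP[le_ij lt_js eq_ij] /forallP/= max_ij.
case: (posnP i) => [i0 | i_gt0]; first by rewrite /run_start i0.
rewrite /run_start (gtn_eqF i_gt0) /=; apply/eqP => eq_i.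
have lt_i1 : i.-1 < size s by rewrite (leq_ltn_trans (leq_pred _)).
have /forallP/(_ j)/implyP := max_ij (Ordinal lt_i1); rewrite leq_pred leqnn /=.
suff -> : equal_letter_run s i.-1 j.
  case/(_ isT)/andP => /eqP/(congr1 val)/= eq_ii.
  by move: i_gt0; case: (val i) eq_ii => // n /n_Sn.
apply/equal_letter_runP; split=> // [|k /andP[le_ik le_kj]].
  exact: leq_trans (leq_pred _) le_ij.
have [lt_ki | le_ik'] := ltnP k i; last by rewrite eq_i eq_ij ?le_ik'.
suff -> : k = i.-1 by [].
by apply/eqP; rewrite eqn_leq le_ik -ltnS (prednK i_gt0) lt_ki.
Qed.

Lemma run_start_ex_maximal_run s (i : 'I_(size s)) :
  run_start s i -> exists j : 'I_(size s), maximal_run i j.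
Proof.
move=> start_i; have run_ii : equal_letter_run s i i.
  by apply/equal_letter_runP; split=> // k; rewrite -eqn_leq => /eqP->.
(* The end [j] is the largest one reachable from [i] by an equal-letter interval. A larger run
   cannot begin before [i], since it would cover both [i.-1] and [i]; so it begins at [i], and the
   choice of [j] bounds its end. *)
case: (@arg_maxnP _ i (fun j : 'I_(size s) => equal_letter_run s i j) val run_ii).
move=> j run_ij max_j.
exists j; apply/andP; split=> //; apply/forallP=> i'; apply/forallP=> j'.
apply/implyP=> /and3P[le_i'i le_jj' run'].
have /equal_letter_runP[le_ij _ _] := run_ij.
have /equal_letter_runP[_ _ eq'] := run'.
have eq_ii' : i' = i.
  apply/val_inj/eqP; rewrite /= eqn_leq le_i'i leqNgt; apply/negP=> lt_i'i.
  have i_gt0 : 0 < i by apply: leq_ltn_trans lt_i'i.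
  case/orP: start_i => [/eqP i0|/eqP[]]; first by rewrite i0 in i_gt0.
  rewrite !eq' ?le_i'i ?(leq_trans le_ij) //.
  by rewrite -ltnS prednK // lt_i'i (leq_trans (leq_pred _)) ?(leq_trans le_ij).
rewrite eq_ii' eqxx -val_eqE eqn_leq le_jj' andbT /=.
by apply: max_j; rewrite -eq_ii'.
Qed.

Lemma maximal_run_end_uniq s (i j j' : 'I_(size s)) :
  maximal_run i j -> maximal_run i j' -> j = j'.
Proof.
wlog le_jj' : j j' / j <= j' => [th run_j run_j'|].
  by case: (leqP j j') => [|/ltnW] /th; [apply | move=> /(_ run_j' run_j)].
case/andP=> _ /forallP/(_ i)/forallP/(_ j')/implyP max_j /andP[run_j' _].
by rewrite leqnn le_jj' run_j' in max_j; case/andP: (max_j isT) => _ /eqP.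
Qed.

(** Sending a run to its left end is injective on maximal runs, and its image is the set of run
    starts. *)
Lemma num_runsE s : num_runs s = #|[set i : 'I_(size s) | run_start s i]|.
Proof.
rewrite /num_runs; set M := [set ij | _].
suff -> : [set i : 'I_(size s) | run_start s i] = fst @: M.
  rewrite card_in_imset // => -[i j] [i' j']; rewrite !inE /= => run run' eq_i.
  by rewrite -{}eq_i in run' *; rewrite (maximal_run_end_uniq run run').
apply/setP=> i; rewrite inE; apply/idP/imsetP.
  by case/run_start_ex_maximal_run=> j run; exists (i, j); rewrite ?inE.
by case=> -[i' j]; rewrite inE /= => /run_start_maximal_run start ->.
Qed.

End Runs.

(** * Lexicographic order and prefixes *)

Section LexicographicPrefix.
Variables (disp : Order.disp_t) (A : orderType disp).
Implicit Types (s t u w : seq A).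

(** By induction on [w]: the first letters of [s] and [u] coincide, which forces that of [t], and
    the comparisons pass to the tails. *)
Lemma prefix_convex w s t u :
  prefix w s -> prefix w u ->
  ((s : seqlexi A) <= (t : seqlexi A))%O ->
  ((t : seqlexi A) <= (u : seqlexi A))%O -> prefix w t.
Proof.
elim: w s t u => [|c w IHw] s t u; first by rewrite !prefix0s.
case: s => [|x s]; first by rewrite prefixs0.
case: u => [|z u]; first by rewrite (prefixs0 (c :: w)).
case: t => [|y t]; first by rewrite lexis0.
rewrite !prefix_cons => /andP[/eqP<- ws] /andP[/eqP<- wu].
rewrite !lexi_cons.
case/andP=> le_cy /implyP le_st /andP[le_yc /implyP le_tu].
have/eqP eq_cy : c == y by rewrite eq_le le_cy le_yc.
by rewrite -eq_cy lexx in le_st le_tu *; rewrite eqxx (IHw s t u) ?le_st ?le_tu.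
Qed.

End LexicographicPrefix.

(** * Order of suffixes and the suffix array *)

Section SuffixArray.
Variables (disp : Order.disp_t) (A : orderType disp).
Implicit Types (T w : seq A).

Lemma suffix_le_refl T : reflexive (suffix_le T).
Proof. by move=> i; rewrite /suffix_le lexx. Qed.

Lemma suffix_le_trans T : transitive (suffix_le T).
Proof. by move=> j i k; apply: le_trans. Qed.

Lemma suffix_le_total T : total (suffix_le T).
Proof. by move=> i j; apply: le_total. Qed.

(** Equal suffixes have equal lengths, and the length of a suffix determines where it starts. *)
Lemma suffix_le_anti T i j : i < size T -> j < size T ->
  suffix_le T i j -> suffix_le T j i -> i = j.
Proof.
move=> lt_i lt_j le_ij le_ji.
have /(congr1 size) : drop i T = drop j T.
  by apply: (@le_anti _ (seqlexi A)); apply/andP.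
rewrite !size_drop => eq_ij.
by rewrite -(subKn (ltnW lt_i)) eq_ij (subKn (ltnW lt_j)).
Qed.

Lemma suffix_leS x0 T i j : i < size T -> j < size T ->
  nth x0 T i = nth x0 T j -> suffix_le T i j = suffix_le T i.+1 j.+1.
Proof.
move=> lt_i lt_j eq_ij.
rewrite /suffix_le (drop_nth x0 lt_i) (drop_nth x0 lt_j) eq_ij.
by rewrite lexi_cons lexx.
Qed.

Lemma size_suffix_array T : size (suffix_array T) = size T.
Proof. by rewrite size_sort size_iota. Qed.

Lemma mem_suffix_array T i : (i \in suffix_array T) = (i < size T).
Proof. by rewrite mem_sort mem_iota. Qed.

Lemma index_suffix_array_lt T i :
  i < size T -> index i (suffix_array T) < size T.
Proof. by rewrite -mem_suffix_array -index_mem size_suffix_array. Qed.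

Lemma nth_suffix_array_lt T k :
  k < size T -> nth 0 (suffix_array T) k < size T.
Proof. by move=> lt_k; rewrite -mem_suffix_array mem_nth ?size_suffix_array. Qed.

Lemma suffix_array_uniq T : uniq (suffix_array T).
Proof. by rewrite sort_uniq iota_uniq. Qed.

Lemma suffix_array_nth_le T a b : a <= b -> b < size T ->
  suffix_le T (nth 0 (suffix_array T) a) (nth 0 (suffix_array T) b).
Proof.
move=> le_ab lt_b.
apply: (sorted_leq_nth (@suffix_le_trans T) (@suffix_le_refl T)) => //.
- exact/sort_sorted/suffix_le_total.
- by rewrite inE size_suffix_array (leq_ltn_trans le_ab).
- by rewrite inE size_suffix_array.
Qed.

Lemma size_bwt dollar T : size (bwt dollar T) = size T.
Proof. by rewrite size_map size_suffix_array. Qed.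

(** First means first in the suffix array, not leftmost in the text. *)
Definition first_occurrence T w (i : nat) : Prop :=
  prefix w (drop i T) /\
  forall k, k < size T -> prefix w (drop k T) -> suffix_le T i k.

Lemma ex_first_occurrence T w i : i < size T -> prefix w (drop i T) ->
  exists2 i', i' < size T & first_occurrence T w i'.
Proof.
move=> lt_i pref_i; pose P k := prefix w (drop k T).
have hasP : has P (suffix_array T).
  by apply/hasP; exists i; rewrite ?mem_suffix_array.
exists (nth 0 (suffix_array T) (find P (suffix_array T))).
  by rewrite -mem_suffix_array mem_nth // -has_find.
split=> [|k lt_k pref_k]; first exact: (nth_find 0 hasP).
have kSA : k \in suffix_array T by rewrite mem_suffix_array.
rewrite -[X in suffix_le T _ X](nth_index 0 kSA).
apply: suffix_array_nth_le; last by rewrite index_suffix_array_lt.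
rewrite leqNgt; apply/negP=> /(before_find 0).
by rewrite nth_index // /P pref_k.
Qed.

End SuffixArray.

(** * The attractor read off the Burrows-Wheeler transform *)

Section Attractor.
Variables (disp : Order.disp_t) (A : orderType disp) (dollar : A) (T : seq A).
Hypothesis hT : dollar_terminated dollar T.

Let n := size T.
Let SA := suffix_array T.

Lemma dollar_terminated_size_gt0 : 0 < n.
Proof. by rewrite /n; case: hT => -[s -> _] _; rewrite size_rcons. Qed.
Let n_gt0 := dollar_terminated_size_gt0.

Lemma nth_dollarE k : k < n -> (nth dollar T k == dollar) = (k == n.-1).
Proof.
rewrite /n; case: hT => -[s -> nds] _; rewrite size_rcons ltnS nth_rcons /=.
rewrite leq_eqVlt => /predU1P[->|lt_ks]; first by rewrite ltnn !eqxx.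
rewrite lt_ks (ltn_eqF lt_ks); apply/eqP=> eq_d.
by rewrite -eq_d mem_nth in nds.
Qed.

(* Text position, cyclically, of the letter in row [k] of the transform. *)
Definition bwt_pos (k : nat) : nat := (nth 0 SA k + n.-1) %% n.

Lemma bwt_posS k : k < n -> 0 < nth 0 SA k -> bwt_pos k = (nth 0 SA k).-1.
Proof.
move=> lt_k SA_gt0; have lt_SA : nth 0 SA k < n by rewrite nth_suffix_array_lt.
rewrite /bwt_pos -{1}(prednK SA_gt0) addSnnS prednK // modnDr modn_small //.
by rewrite (leq_ltn_trans (leq_pred _)).
Qed.

Lemma bwt_pos0 k : nth 0 SA k = 0 -> bwt_pos k = n.-1.
Proof. by rewrite /bwt_pos => ->; rewrite add0n modn_small ?prednK. Qed.

Lemma nth_bwt k : k < n -> nth dollar (bwt dollar T) k =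
  nth dollar T (bwt_pos k).
Proof.
move=> lt_k; rewrite (nth_map 0) ?size_suffix_array //.
case: posnP => [SA0|SA_gt0].
  (* The cyclic predecessor of position 0 is the last position, which carries [dollar], the letter
     that [bwt] puts in this row. *)
  by apply/esym/eqP; rewrite (bwt_pos0 SA0) nth_dollarE ?prednK.
by rewrite bwt_posS.
Qed.

Lemma bwt_pos_inj a b : a < n -> b < n -> bwt_pos a = bwt_pos b -> a = b.
Proof.
move=> lt_a lt_b /eqP; rewrite eqn_modDr.
rewrite !modn_small ?nth_suffix_array_lt //.
rewrite nth_uniq ?size_suffix_array ?suffix_array_uniq //.
by move/eqP.
Qed.

Lemma bwt_pos_surj i : i < n -> exists2 k, k < n & bwt_pos k = i.
Proof.
move=> lt_i; have kSA : (i.+1 %% n) \in SA by rewrite mem_suffix_array ltn_pmod.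
exists (index (i.+1 %% n) SA); first by rewrite index_suffix_array_lt ?ltn_pmod.
by rewrite /bwt_pos nth_index // modnDml addSnnS prednK // modnDr modn_small.
Qed.

Lemma run_start_in_first_occurrence w i : w != [::] -> i < n ->
  first_occurrence T w i ->
  exists k p, [/\ k < n, run_start dollar (bwt dollar T) k, p = bwt_pos k
                & i <= p < i + size w].
Proof.
elim: w i => // c w IHw i _ lt_i [pref_i min_i].
(* Row [k] is the one whose transform letter sits at text position [i]; if it starts a run, [i]
   itself is the required position. *)
have [k lt_k pos_k] := bwt_pos_surj lt_i.
have [start_k | not_start] := boolP (run_start dollar (bwt dollar T) k).
  by exists k, i; split; rewrite // leqnn /= addnS ltnS leq_addr.
move: not_start; rewrite /run_start negb_or negbK -lt0n => /andP[k_gt0 /eqP].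
have lt_k1 : k.-1 < n by rewrite (leq_ltn_trans (leq_pred _)).
have lt_k1k : k.-1 < k by rewrite prednK.
rewrite !nth_bwt // pos_k => eq_c.
have lt_p : bwt_pos k.-1 < n by rewrite ltn_pmod.
have neq_pi : bwt_pos k.-1 != i.
  apply/eqP; rewrite -pos_k => /bwt_pos_inj eq_k.
  by move: lt_k1k; rewrite {1}eq_k ?ltnn.
(* Two distinct positions with the same letter cannot carry [dollar], so neither is the last one.
   Hence no wrap-around occurs, and rows [k] and [k.-1] hold the suffixes that start one position
   further. *)
have i_last : i != n.-1.
  apply: contra neq_pi => /[dup] i1; rewrite -nth_dollarE // -eq_c nth_dollarE //.
  by rewrite (eqP i1).
have p_last : bwt_pos k.-1 != n.-1.
  by rewrite -nth_dollarE // eq_c nth_dollarE.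
have SAk : nth 0 SA k = i.+1.
  have [/bwt_pos0|SA_gt0] := posnP (nth 0 SA k).
    by rewrite pos_k => /eqP; rewrite (negPf i_last).
  by rewrite -pos_k bwt_posS // prednK.
have SAk1 : nth 0 SA k.-1 = (bwt_pos k.-1).+1.
  have [/bwt_pos0/eqP|SA_gt0] := posnP (nth 0 SA k.-1).
    by rewrite (negPf p_last).
  by rewrite bwt_posS // prednK.
set p := bwt_pos k.-1 in eq_c lt_p neq_pi p_last SAk1.
have le_pi1 : suffix_le T p.+1 i.+1.
  by rewrite -SAk -SAk1 suffix_array_nth_le // ltnW.
have le_pi : suffix_le T p i by rewrite (suffix_leS lt_p lt_i eq_c).
move: pref_i; rewrite (drop_nth dollar lt_i) prefix_cons.
case/andP=> /eqP eq_ci pref_i1.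
(* Otherwise [c :: w] would occur at [bwt_pos k.-1], whose suffix does not come after the one at
   [i]; minimality of [i] would make the two positions equal. *)
have npref_p : ~~ prefix w (drop p.+1 T).
  apply: contra neq_pi => pref_p1; apply/eqP/(suffix_le_anti lt_p lt_i le_pi).
  apply: min_i => //; rewrite (drop_nth dollar lt_p) prefix_cons.
  by rewrite eq_ci eq_c eqxx.
have w_neq0 : w != [::] by apply: contraNneq npref_p => ->; rewrite prefix0s.
have lt_i1 : i.+1 < n by rewrite -SAk nth_suffix_array_lt.
case: (IHw i.+1 w_neq0 lt_i1) =>
  [|k' [q [lt_k' start_k' -> /andP[lt_iq lt_q]]]]; last first.
  by exists k', (bwt_pos k'); rewrite /= addnS -addSn (ltnW lt_iq).
(* If [m] stood before row [k], then row [k.-1] would lie between two suffixes starting with [w],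
   and by convexity would itself start with [w]. *)
split=> // m lt_m pref_m.
have mSA : m \in SA by rewrite mem_suffix_array.
have lt_im : index m SA < n by rewrite index_suffix_array_lt.
rewrite -SAk -(nth_index 0 mSA); apply: suffix_array_nth_le => //.
rewrite leqNgt; apply: contra npref_p => lt_mk.
apply: (prefix_convex pref_m pref_i1); last exact: le_pi1.
rewrite -/(suffix_le T m p.+1) -SAk1 -(nth_index 0 mSA).
by apply: suffix_array_nth_le; rewrite // -ltnS prednK.
Qed.

Definition bwt_pos_ord (k : 'I_(size (bwt dollar T))) : 'I_(size T) :=
  Ordinal (ltn_pmod (nth 0 SA k + n.-1) n_gt0).

Definition run_start_attractor : {set 'I_(size T)} :=
  bwt_pos_ord @: [set k : 'I_(size (bwt dollar T)) |
                  run_start dollar (bwt dollar T) k].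

(** Distinct rows have distinct text positions, so no run start is lost in the image. *)
Lemma card_run_start_attractor :
  #|run_start_attractor| = num_runs (bwt dollar T).
Proof.
rewrite (num_runsE dollar) card_imset // => a b [eq_ab]; apply/val_inj.
have lt_n (k : 'I_(size (bwt dollar T))) : k < n.
  by have := ltn_ord k; rewrite [X in _ < X]size_bwt.
exact: (bwt_pos_inj (lt_n a) (lt_n b) eq_ab).
Qed.

Lemma run_start_attractorP : string_attractor run_start_attractor.
Proof.
move=> i j le_ij; set w := substring T i j.
have size_w : size w = j.+1 - i by rewrite size_takel // size_drop leq_sub2r.
have w_neq0 : w != [::] by rewrite -size_eq0 size_w subn_eq0 -ltnNge ltnS.
have pref_w : prefix w (drop i T) by rewrite prefix_take.
have [i' lt_i' first_i'] := ex_first_occurrence (ltn_ord i) pref_w.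
have [k [p [lt_k start_k p_k /andP[le_i'p lt_p]]]] :=
  run_start_in_first_occurrence w_neq0 lt_i' first_i'.
have [pref_i' _] := first_i'.
have le_iw : i' + size w <= size T.
  have /size_prefix := pref_i'.
  by rewrite size_drop leq_subRL // ltnW.
have w_gt0 : 0 < size w by rewrite lt0n size_eq0.
(* Right ends are inclusive, so the occurrence of [w] at [i'] ends at [(i' + size w).-1]; this is a
   valid position as [w] is nonempty. *)
have lt_j' : (i' + size w).-1 < size T by rewrite prednK // addn_gt0 w_gt0 orbT.
have lt_kb : k < size (bwt dollar T) by rewrite size_bwt.
exists (Ordinal lt_i'), (Ordinal lt_j'), (bwt_pos_ord (Ordinal lt_kb)).
split.
- rewrite -/w /substring /= prednK ?addn_gt0 ?w_gt0 ?orbT // addKn.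
  by apply/eqP; rewrite -prefixE.
- by rewrite imset_f ?inE.
- by rewrite /= -/(bwt_pos k) -p_k le_i'p -ltnS prednK ?addn_gt0 ?w_gt0 ?orbT.
Qed.

End Attractor.

Theorem theorem3p9 (disp : Order.disp_t) (A : orderType disp)
    (dollar : A) (T : seq A) (hT : dollar_terminated dollar T) :
  exists G : {set 'I_(size T)},
    string_attractor G /\ #|G| = num_runs (bwt dollar T).
Proof.
exists (run_start_attractor hT); split.
  exact: run_start_attractorP.
exact: card_run_start_attractor.
Qed.
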